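(* Let $G$ be a directed graph, $A$ a node-weighting of $G$, and $h\ge1$, $\phi<1$, $s\ge1$. Then: (1) If $A$ is $(h,s)$-length $\phi$-expanding in $G$, then every $A$-respecting $h$-length symmetric demand can be routed in $G$ with congestion at most $O(\log N/\phi)$ and length at most $h\cdot s$. (2) If $A$ is not $(h,s)$-length $\phi$-expanding in $G$, then some $A$-respecting $h$-length symmetric demand cannot be routed in $G$ with congestion at most $\frac{1}{2\phi}$ and length at most $\frac{h\cdot s}{2}$.
   Context: Standing assumptions: $G=(V,E)$ is a finite directed graph with $n=|V|$; every edge $e$ has a length $\ell(e)$ and capacity $u(e)$, positive integers bounded by $N=\mathrm{poly}(n)$. $\mathrm{dist}_G(v,w)$ is the minimum total length of a directed $v\to w$ path. Node-weighting $A:V\to\mathbb{R}_{\ge0}$; demand $D:V\times V\to\mathbb{R}_{\ge0}$; $D$ is $A$-respecting if $\max\{\sum_wD(v,w),\sum_wD(w,v)\}\le A(v)$ for all $v$; $h$-length if $D(v,w)>0\Rightarrow \mathrm{dist}_G(v,w)\le h$; symmetric if $D(v,w)=D(w,v)$. An $H$-length moving cut ($H>0$) is $C:E\to\{0,\tfrac1H,\tfrac2H,\dots\}\cap[0,1]$, size $|C|=\sum_eu(e)C(e)$, and $G-C$ is $G$ with lengths $\ell(e)+H\cdot C(e)$. $\mathrm{sep}_{h'}(C,D)=\sum_{(u,v):\mathrm{dist}_{G-C}(u,v)>h'}D(u,v)$, $\mathrm{spars}_{h'}(C,D)=|C|/\mathrm{sep}_{h'}(C,D)$ (when the separation is positive).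 For an $hs$-length moving cut $C$, $\mathrm{spars}_{(h,s)}(C,A)=\min\mathrm{spars}_{hs}(C,D)$ over $A$-respecting $h$-length symmetric demands $D$ (zero separation counts as $+\infty$); the $(h,s)$-length conductance of $A$ is the minimum of this over all $hs$-length moving cuts; $A$ is $(h,s)$-length $\phi$-expanding if the conductance is at least $\phi$. A flow assigns nonnegative values to simple directed paths; it routes $D$ if for each ordered pair $(v,w)$ the total value on $v\to w$ paths equals $D(v,w)$; its congestion is $\max_e(\text{flow through }e)/u(e)$ and its length is the maximum length of a path with positive value. *)

(* Defs.v *)
From HB Require Import structures.
From mathcomp Require Import all_boot all_order all_algebra.
From mathcomp Require Import all_classical all_reals ereal exp.
Set Implicit Arguments. Unset Strict Implicit. Unset Printing Implicit Defensive.
Import Order.TTheory GRing.Theory Num.Theory.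
Local Open Scope classical_set_scope.
Local Open Scope ring_scope.

(* A finite directed (multi)graph: vertices V, edges E, edge e goes src e -> dst e.
   Lengths of edges are given as real-valued functions [l : E -> R] so that the
   graph G - C (with lengths l(e) + H*C(e)) can be handled uniformly. *)
Section Graph.
Variables (R : realType) (V E : finType) (src dst : E -> V).

Fixpoint is_walk (v w : V) (p : seq E) : bool :=
  match p with
  | [::] => v == w
  | e :: p' => (src e == v) && is_walk (dst e) w p'
  end.

Definition is_simple_path (v w : V) (p : seq E) : bool :=
  is_walk v w p && uniq (v :: map dst p).

Definition plen (l : E -> R) (p : seq E) : R := \sum_(e <- p) l e.

(* dist_l(v,w) = minimum total length of a directed v -> w path (+oo if none);
   written as the infimum over all directed walks (attained, lengths positive). *)
Definition dist (l : E -> R) (v w : V) : \bar R :=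
  ereal_inf [set (plen l p)%:E | p in [set p | is_walk v w p]].

Definition lenR (len : E -> nat) : E -> R := fun e => (len e)%:R.

Definition moving_cut (H : R) (C : E -> R) : Prop :=
  forall e, (exists k : nat, C e = k%:R / H) /\ 0 <= C e <= 1.

Definition cut_size (cap : E -> nat) (C : E -> R) : R :=
  \sum_(e : E) (cap e)%:R * C e.

Definition len_minus_cut (len : E -> nat) (H : R) (C : E -> R) : E -> R :=
  fun e => (len e)%:R + H * C e.

Definition demand_nonneg (D : V -> V -> R) : Prop := forall v w, 0 <= D v w.

Definition A_respecting (A : V -> R) (D : V -> V -> R) : Prop :=
  forall v, Num.max (\sum_w D v w) (\sum_w D w v) <= A v.

Definition h_length (len : E -> nat) (h : R) (D : V -> V -> R) : Prop :=
  forall v w, 0 < D v w -> (dist (lenR len) v w <= h%:E)%E.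

Definition symmetric_demand (D : V -> V -> R) : Prop := forall v w, D v w = D w v.

Definition valid_demand (len : E -> nat) (A : V -> R) (h : R) (D : V -> V -> R) :=
  [/\ demand_nonneg D, A_respecting A D, h_length len h D & symmetric_demand D].

Definition sep (len : E -> nat) (H : R) (C : E -> R) (h' : R) (D : V -> V -> R) : R :=
  \sum_(p : V * V | (h'%:E < dist (len_minus_cut len H C) p.1 p.2)%E) D p.1 p.2.

Definition spars (len cap : E -> nat) (H : R) (C : E -> R) (h' : R)
    (D : V -> V -> R) : \bar R :=
  if 0 < sep len H C h' D then (cut_size cap C / sep len H C h' D)%:E else +oo%E.

Definition spars_hs (len cap : E -> nat) (h s : R) (C : E -> R) (A : V -> R) : \bar R :=
  ereal_inf [set spars len cap (h * s) C (h * s) D | D in [set D | valid_demand len A h D]].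

Definition conductance (len cap : E -> nat) (h s : R) (A : V -> R) : \bar R :=
  ereal_inf [set spars_hs len cap h s C A | C in [set C | moving_cut (h * s) C]].

Definition expanding (len cap : E -> nat) (h s phi : R) (A : V -> R) : Prop :=
  (phi%:E <= conductance len cap h s A)%E.

(* A flow: a finite list of weighted simple paths ((v, w, p), x), meaning value x
   on the simple v -> w path p (repetitions are added up). *)
Definition flow := seq (V * V * seq E * R).

Definition flow_wf (F : flow) : Prop :=
  forall q, q \in F -> is_simple_path q.1.1.1 q.1.1.2 q.1.2 /\ 0 <= q.2.

Definition routes (D : V -> V -> R) (F : flow) : Prop :=
  flow_wf F /\
  forall v w, \sum_(q <- F | (q.1.1.1 == v) && (q.1.1.2 == w)) q.2 = D v w.

Definition edge_flow (F : flow) (e : E) : R := \sum_(q <- F | e \in q.1.2) q.2.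

Definition congestion_le (cap : E -> nat) (F : flow) (c : R) : Prop :=
  forall e, edge_flow F e / (cap e)%:R <= c.

Definition flow_length_le (len : E -> nat) (F : flow) (L : R) : Prop :=
  forall q, q \in F -> 0 < q.2 -> plen (lenR len) q.1.2 <= L.

Definition routable (len cap : E -> nat) (D : V -> V -> R) (c L : R) : Prop :=
  exists F : flow, [/\ routes D F, congestion_le cap F c & flow_length_le len F L].

End Graph.

(* Main.v *)
Require Import Defs.
From HB Require Import structures.
From mathcomp Require Import all_boot all_order all_algebra.
From mathcomp Require Import ring lra.
From mathcomp Require Import all_classical all_reals ereal sequences exp.
Set Implicit Arguments. Unset Strict Implicit. Unset Printing Implicit Defensive.
Import Order.TTheory GRing.Theory Num.Theory.
Local Open Scope ring_scope.

(* For (2), a flow of length at most hs/2 must put C-weight above 1/2 on every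
   path between pairs that C separates, so its congestion bounds sep(C, D) by
   2 * congestion * |C|.

   For (1), by Farkas' lemma routability fails only if there are edge weights
   w >= 0 and values y(u,v), at most w(p) for every simple u -> v path p of
   length <= hs, with sum D y > congestion * sum cap w.  For every t > 0 the
   moving cut that rounds hs * min(2 w / t, 1) down to an integer, and drops
   the edges with w < t / (2N), separates all pairs with y >= t: an edge has
   length at least 1, which pays for its rounding, and a simple path has at
   most N edges.  Expansion then bounds D(y >= t) by |C_t| / phi.  Summing over
   the scales t = t0 * 2^i, an edge e contributes min(2 w(e), t) at the scales
   t <= 2N w(e) only: a geometric series plus O(log N) terms, i.e.
   O(w(e) log N). *)

(** * Farkas' lemma over an ordered field *)

(** Induction on the constraints. If [k] is redundant, its coefficient is 0; otherwise some [x]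
    meets the constraints of [s] with [g] positive, which forces [b k > 0], and projecting along [x]
    onto the kernel of [a k] reduces to [s]. *)
Lemma farkas (F : realFieldType) (I : finType) (J : eqType) (a : J -> I -> F)
    (s : seq J) (g : I -> F) :
  uniq s ->
  (forall x : I -> F, (forall j, j \in s -> \sum_i a j i * x i <= 0) ->
     \sum_i g i * x i <= 0) ->
  exists c : J -> F, (forall j, 0 <= c j) /\
    (forall i, g i = \sum_(j <- s) c j * a j i).
Proof.
elim: s a g => [|k s IHs] a g /= => [_ gle0|/andP[kNs us] gle0].
  exists (fun=> 0); split=> // i; rewrite big_nil.
  (* With no constraint left, testing [g] on itself bounds a sum of squares by 0. *)
  have /= := gle0 g (fun j => ltac:(by [])).
  have ge0 j : true -> 0 <= g j * g j by rewrite -expr2 sqr_ge0.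
  move=> le0; have /eqP : \sum_i g i * g i = 0.
    by apply/eqP; rewrite eq_le le0 sumr_ge0.
  by rewrite psumr_eq0 // => /allP/(_ i); rewrite mem_index_enum mulf_eq0 orbb => /(_ isT)/eqP.
have [gs|] := pselect (forall x : I -> F,
    (forall j, j \in s -> \sum_i a j i * x i <= 0) -> \sum_i g i * x i <= 0).
  have [c [c0 cg]] := IHs a g us gs.
  exists (fun j => if j == k then 0 else c j); split=> [j|i].
    by case: ifP.
  rewrite big_cons eqxx mul0r add0r cg; apply: eq_big_seq => j js.
  by case: eqP js kNs => // -> ->.
move=> /existsNP[x /not_implyP[xs /negP]]; rewrite -ltNge => gx.
pose b j := \sum_i a j i * x i; pose gb := \sum_i g i * x i.
have bk : 0 < b k.
  rewrite ltNge; apply/negP => bk; move: gx; rewrite ltNge gle0 // => j.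
  by rewrite inE => /predU1P[->|/xs].
pose a' j i := a j i - b j / b k * a k i.
pose g' i := g i - gb / b k * a k i.
(* Projecting along [x] onto the hyperplane of the last constraint. *)
have proj (f : I -> F) (r : F) (z : I -> F) : r = \sum_i f i * x i ->
    \sum_i (f i - r / b k * a k i) * z i =
    \sum_i f i * (z i - (\sum_i a k i * z i) / b k * x i).
  move=> rE; under eq_bigr do rewrite mulrBl.
  under [RHS]eq_bigr do rewrite mulrBr.
  rewrite !sumrB; congr (_ - _).
  under [RHS]eq_bigr do rewrite mulrCA.
  rewrite -[RHS]mulr_sumr -rE !mulr_suml.
  by apply: eq_bigr => i _; ring.
have [|c [c0 cg]] := IHs a' g' us.
  move=> z zs; rewrite /g' (proj g gb) //; apply: gle0 => j.
  rewrite inE => /predU1P[->|js]; last by rewrite -(proj (a j) (b j)) // zs.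
  (* The projected point satisfies constraint [k] with equality. *)
  rewrite -(proj (a k) (b k)) // big1 // => i _.
  by rewrite divff ?gt_eqF // mul1r subrr mul0r.
(* Undoing the projection determines the coefficient of [k]; it is nonnegative since [gb > 0] while
   [b j <= 0] on [s]. *)
exists (fun j => if j == k then (gb - \sum_(j <- s) c j * b j) / b k else c j).
split=> [j|i].
  case: ifP => // _; apply: divr_ge0; last exact: ltW.
  rewrite subr_ge0; apply: (@le_trans _ _ 0); last exact: ltW.
  rewrite big_seq; apply: sumr_le0 => i si.
  by rewrite mulr_ge0_le0 // /b xs.
rewrite big_cons eqxx.
have -> : \sum_(j <- s) (if j == k then (gb - \sum_(j <- s) c j * b j) / b k
    else c j) * a j i = \sum_(j <- s) c j * a j i.
  by apply: eq_big_seq => j js; case: eqP js kNs => // -> ->.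
have := cg i; rewrite /g' /a'.
under eq_bigr do rewrite mulrBr; rewrite sumrB.
have -> : \sum_(j <- s) c j * (b j / b k * a k i) =
    (\sum_(j <- s) c j * b j) / b k * a k i.
  by rewrite !mulr_suml; apply: eq_bigr => j _; rewrite !mulrA.
by move/eqP; rewrite subr_eq => /eqP ->; rewrite mulrBl mulrBl; ring.
Qed.

(** * Dyadic scales *)

(** The scales before a given one add up to at most that one, so the sum is at most twice its
    largest term. *)
Lemma sum_dyadic_le (R : realFieldType) (t x : R) (M : nat) : 0 < t -> 0 <= x ->
  \sum_(i < M | t * 2 ^+ i <= x) t * 2 ^+ i <= 2 * x.
Proof.
move=> t0 x0; elim: M => [|M IH]; first by rewrite big_ord0 mulr_ge0.
rewrite big_mkcond big_ord_recr /= -big_mkcond /=; case: ifP => [tx|_]; last by rewrite addr0.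
have H : \sum_(i < M | t * 2 ^+ i <= x) t * 2 ^+ i <= t * 2 ^+ M.
  apply: (@le_trans _ _ (\sum_(i < M) t * 2 ^+ i)).
    rewrite [leLHS]big_mkcond; apply: ler_sum => i _; case: ifP => // _.
    by rewrite mulr_ge0 ?exprn_ge0 // ltW.
  rewrite -mulr_sumr ler_pM2l //.
  by elim: M {IH tx} => [|M IH]; rewrite ?big_ord0 // big_ord_recr exprS /=; lra.
by lra.
Qed.

(** Distinct scales differ by a factor of at least 2, too much for the half-open interval
    [(x, 2x]]. *)
Lemma count_dyadic1_le (R : realFieldType) (t x : R) (M : nat) : 0 < t ->
  \sum_(i < M | x < t * 2 ^+ i <= 2 * x) 1 <= 1 :> R.
Proof.
move=> t0; elim: M => [|M IH]; first by rewrite big_ord0.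
rewrite big_mkcond big_ord_recr /= -big_mkcond /=.
case: ifP => [/andP[_ tx]|_]; last by rewrite addr0.
rewrite big1 ?add0r // => i /andP[xt _]; exfalso.
have : t * 2 ^+ i.+1 <= t * 2 ^+ M.
  by rewrite ler_pM2l // ler_eXn2l // ltr1n.
by rewrite exprS; lra.
Qed.

(** The interval [(x, 2^K x]] splits into [K] half-open intervals of ratio 2. *)
Lemma count_dyadic_le (R : realFieldType) (t x : R) (M K : nat) : 0 < t -> 0 <= x ->
  \sum_(i < M | x < t * 2 ^+ i <= 2 ^+ K * x) 1 <= K%:R :> R.
Proof.
move=> t0 x0; elim: K => [|K IH].
  by rewrite big1 // => i; rewrite expr0 mul1r => /andP[/lt_le_trans h/h]; rewrite ltxx.
apply: (@le_trans _ _ (\sum_(i < M | x < t * 2 ^+ i <= 2 ^+ K * x) 1 +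
  \sum_(i < M | 2 ^+ K * x < t * 2 ^+ i <= 2 * (2 ^+ K * x)) 1)); last first.
  by rewrite -[K.+1]addn1 natrD; apply: lerD => //; exact: count_dyadic1_le.
rewrite big_mkcond [X in _ <= X + _]big_mkcond [X in _ <= _ + X]big_mkcond -big_split /=.
apply: ler_sum => i _; rewrite exprS -mulrA.
case: (ltP x) => //= _; last by case: ifP; lra.
by case: (leP _ (2 ^+ K * x)) => /= _; repeat case: ifP => _; lra.
Qed.

(** For positive [y], the largest scale not above [y] is at least [y / 2]; it exists because
    [t <= y]. *)
Lemma le_sum_dyadic (R : realFieldType) (t y : R) (M : nat) : 0 < t ->
  y <= t * 2 ^+ M -> (0 < y -> t <= y) ->
  y <= 2 * \sum_(i < M.+1 | t * 2 ^+ i <= y) t * 2 ^+ i.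
Proof.
have term0 n : 0 < t -> 0 <= t * 2 ^+ n.
  by move=> t0; rewrite mulr_ge0 ?exprn_ge0 // ltW.
move=> t0 yM ty; have S0 n : 0 <= \sum_(i < n | t * 2 ^+ i <= y) t * 2 ^+ i.
  by apply: sumr_ge0 => i _; exact: term0.
have [y0|/ty {}ty] := leP y 0; first by rewrite (le_trans y0) // mulr_ge0.
elim: M yM => [yM|M IH yM].
  by rewrite big_mkcond big_ord1 /= expr0 mulr1 ty; rewrite expr0 mulr1 in yM; lra.
rewrite big_mkcond big_ord_recr -big_mkcond /=.
have [yM'|yM'] := leP y (t * 2 ^+ M).
  apply: le_trans (IH yM') _; rewrite ler_pM2l // lerDl; case: ifP => // _.
  exact: term0.
rewrite big_mkcond big_ord_recr -big_mkcond /= (ltW yM').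
have := S0 M; have := term0 M.+1 t0; rewrite exprS in yM *.
by case: ifP => _; lra.
Qed.

(** * Directed walks and simple paths *)

Section Paths.
Variables (R : realType) (V E : finType) (src dst : E -> V).

Lemma plen_cons (l : E -> R) e p : plen l (e :: p) = l e + plen l p.
Proof. exact: big_cons. Qed.

Lemma plen_ge0 (l : E -> R) p : (forall e, 0 <= l e) -> 0 <= plen l p.
Proof. by move=> l0; apply: sumr_ge0. Qed.

Lemma plenD (l1 l2 : E -> R) p : plen (fun e => l1 e + l2 e) p = plen l1 p + plen l2 p.
Proof. exact: big_split. Qed.

Lemma plenZ (c : R) (l : E -> R) p : plen (fun e => c * l e) p = c * plen l p.
Proof. by rewrite [RHS]mulr_sumr. Qed.

Lemma le_plen (l1 l2 : E -> R) p : (forall e, l1 e <= l2 e) -> plen l1 p <= plen l2 p.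
Proof. by move=> l12; apply: ler_sum. Qed.

Lemma simple_path_uniq v w p : is_simple_path src dst v w p -> uniq p.
Proof. by move=> /andP[_ /=/andP[_ /map_uniq]]. Qed.

Lemma simple_path_size v w p : is_simple_path src dst v w p -> (size p < #|V|)%N.
Proof.
move=> /andP[_ up]; rewrite -(size_map dst) -/(size (v :: map dst p)).
by rewrite -(card_uniqP up) max_card.
Qed.

Lemma simple_path_suffix u v w p : is_simple_path src dst u w p ->
  v \in u :: map dst p ->
  exists q, [/\ is_simple_path src dst v w q &
    forall l : E -> R, (forall e, 0 <= l e) -> plen l q <= plen l p].
Proof.
elim: p u => [|e p IHp] u sp.
  by rewrite inE => /eqP ->; exists [::].
rewrite inE => /predU1P[->|]; first by exists (e :: p).
move: sp => /andP[/= /andP[_ wp] /andP[_ up]] vp.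
have [|q [sq lq]] := IHp (dst e) _ vp; first exact/andP.
exists q; split=> // l l0; apply: le_trans (lq l l0) _.
by rewrite plen_cons lerDr.
Qed.

(** Prepending an edge to a simple path can only close a cycle at [v]; the suffix from [v] on then
    avoids it. *)
Lemma walk_simple_path v w p : is_walk src dst v w p ->
  exists q, [/\ is_simple_path src dst v w q &
    forall l : E -> R, (forall e, 0 <= l e) -> plen l q <= plen l p].
Proof.
elim: p v => [|e p IHp] v /=; first by move=> /eqP ->; exists [::]; rewrite /is_simple_path /= eqxx.
move=> /andP[se /IHp[q [sq lq]]].
have [vq|vNq] := boolP (v \in dst e :: map dst q).
  have [q' [sq' lq']] := simple_path_suffix sq vq.
  exists q'; split=> // l l0; apply: le_trans (lq' l l0) _.
  by rewrite plen_cons (le_trans (lq l l0)) // lerDr.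
exists (e :: q); split; last by move=> l l0; rewrite !plen_cons lerD2l lq.
by move: sq => /andP[wq uq]; apply/andP; split; rewrite /= ?se //; apply/andP.
Qed.

Lemma dist_le_plen (l : E -> R) v w p : is_walk src dst v w p ->
  (dist src dst l v w <= (plen l p)%:E)%E.
Proof. by move=> wp; apply: ereal_inf_lbound; exists p. Qed.

Lemma moving_cut_size_ge0 (cap : E -> nat) (H : R) (C : E -> R) :
  moving_cut H C -> 0 <= cut_size cap C.
Proof. by move=> mC; apply: sumr_ge0 => e _; case: (mC e) => _ /andP[C0 _]; rewrite mulr_ge0. Qed.

(** * Moving cuts against flows *)

Section Capacities.
Variables len cap : E -> nat.

(** Double counting: a simple path uses an edge at most once, so its [C]-weight is a sum over the
    set of its edges. *)
Lemma sum_flow_plen (D : V -> V -> R) (F : flow R V E) (C : E -> R) :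
  routes src dst D F ->
  \sum_(q <- F) q.2 * plen C q.1.2 = \sum_e C e * edge_flow F e.
Proof.
move=> [wF _]; under [RHS]eq_bigr do rewrite mulr_sumr.
rewrite (exchange_big_dep predT) //= !big_seq; apply: eq_bigr => q qF.
have [sp _] := wF q qF.
rewrite /plen (big_uniq _ (simple_path_uniq sp)) mulr_sumr.
by apply: eq_bigr => e _; rewrite mulrC.
Qed.

(** A form of expansion without division: zero separation, where [spars] is [+oo], needs only that
    the cut size is nonnegative. *)
Lemma expanding_sep_le (h s phi : R) (A : V -> R) (C : E -> R) (D : V -> V -> R) :
  expanding src dst len cap h s phi A -> valid_demand src dst len A h D ->
  moving_cut (h * s) C ->
  phi * sep src dst len (h * s) C (h * s) D <= cut_size cap C.
Proof.
move=> ex vD mC.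
have: (phi%:E <= spars src dst len cap (h * s) C (h * s) D)%E.
  apply: le_trans ex _; apply: ge_ereal_inf; exists (spars_hs src dst len cap h s C A).
    by exists C.
  by apply: ereal_inf_lbound; exists D.
have sep0 : 0 <= sep src dst len (h * s) C (h * s) D.
  by apply: sumr_ge0 => p _; case: vD.
rewrite /spars; case: (ltP 0 (sep _ _ _ _ _ _ _)) => [sep_gt0|sep_le0 _].
  by rewrite lee_fin ler_pdivlMr.
have -> : sep src dst len (h * s) C (h * s) D = 0 by apply/eqP; rewrite eq_le sep_le0.
by rewrite mulr0 (moving_cut_size_ge0 _ mC).
Qed.

Lemma not_expanding_unroutable (h s phi : R) (A : V -> R) :
  (forall e, 0 < cap e)%N -> 0 < h * s -> 0 < phi ->
  ~ expanding src dst len cap h s phi A ->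
  exists D : V -> V -> R, valid_demand src dst len A h D /\
    ~ routable src dst len cap D (1 / (2 * phi)) (h * s / 2).
Proof.
move=> cap0 hs0 phi0 /negP; rewrite -ltNge => /ereal_inf_lt[_ [C mC <-]].
move=> /ereal_inf_lt[_ [D vD <-]]; rewrite /spars; case: ifP => // sep0.
rewrite lte_fin ltr_pdivrMr // => ltC; exists D; split=> // -[F [rF cF lF]].
have C0 e : 0 <= C e by case: (mC e) => _ /andP[].
(* Upper bound: the congestion limits the flow on [e] to [cap e / (2 phi)]. *)
have Chi : \sum_(q <- F) q.2 * plen C q.1.2 <= cut_size cap C / (2 * phi).
  rewrite (sum_flow_plen _ rF) mulr_suml; apply: ler_sum => e _.
  rewrite [leRHS]mulrAC mulrC ler_wpM2r //.
  by have := cF e; rewrite ler_pdivrMr ?ltr0n // mul1r mulrC.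
have Clo : sep src dst len (h * s) C (h * s) D / 2 <= \sum_(q <- F) q.2 * plen C q.1.2.
  pose P (p : V * V) := ((h * s)%:E < dist src dst (len_minus_cut len (h * s) C) p.1 p.2)%E.
  (* Grouping the flow paths by their end points recovers [D], since [F] routes [D]. *)
  have -> : sep src dst len (h * s) C (h * s) D = \sum_(q <- F | P q.1.1) q.2.
    rewrite (partition_big (fun q => q.1.1) P) //=; apply: eq_bigr => -[v w] Pvw /=.
    rewrite -(rF.2 v w); apply: eq_bigl => -[[[v' w'] p] x] /=.
    by rewrite -xpair_eqE; case: eqP => [->|_]; rewrite ?andbF ?andbT.
  rewrite mulr_suml big_mkcond !big_seq; apply: ler_sum => q qF.
  have [sp x0] := rF.1 q qF; case: ifP => Pq; last first.
    by rewrite mulr_ge0 // plen_ge0.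
  (* The length bound covers only paths of positive value; the others contribute 0. *)
  have [x_gt0|] := ltP 0 q.2; last by rewrite le_eqVlt ltNge x0 orbF => /eqP ->; rewrite !mul0r.
  rewrite ler_pM2l //; apply: ltW.
  have /andP[wp _] := sp.
  have := lt_le_trans Pq (dist_le_plen (len_minus_cut len (h * s) C) wp).
  rewrite lte_fin plenD plenZ; have := lF q qF x_gt0; rewrite /lenR => lq ltq.
  by rewrite -(ltr_pM2l hs0); lra.
have : cut_size cap C / (2 * phi) < sep src dst len (h * s) C (h * s) D / 2.
  by rewrite ltr_pdivrMr ?mulr_gt0 //; apply: lt_le_trans ltC _; lra.
by lra.
Qed.

End Capacities.
End Paths.

(** * Logarithmic estimates *)

(** The bound [expR x >= 1 + x] at [x = -1/2] gives [expR (1/2) <= 2]. *)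
Lemma ln2_ge_half (R : realType) : 2^-1 <= ln 2 :> R.
Proof.
rewrite -ler_expR lnK ?posrE //.
have := expR_ge1Dx (- 2^-1 : R); rewrite expRN => le1.
have e0 := expR_gt0 (2^-1 : R).
have : expR 2^-1 * (1 - 2^-1) <= 1 :> R by rewrite -ler_pdivlMl // mulr1.
by lra.
Qed.

(** For the truncated logarithm [L], [6 + 2 L <= 8 L] as [L >= 1], and [L <= 2 ln N] as [2 ^ L <= N]
    and [ln 2 >= 1/2]. *)
Lemma trunc_log2_le_ln (R : realType) (N : nat) : (2 <= N)%N ->
  6 + 2 * (trunc_log 2 N)%:R <= 16 * ln N%:R :> R.
Proof.
move=> N2; set L := trunc_log 2 N.
have L1 : 1 <= L%:R :> R by rewrite ler1n trunc_log_gt0.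
have : L%:R * ln 2 <= ln N%:R :> R.
  rewrite mulr_natl -lnXn //  ler_ln ?posrE ?exprn_gt0 ?ltr0n //; last exact: ltnW.
  by rewrite -natrX ler_nat trunc_logP // ltnW.
have := @ln2_ge_half R; nra.
Qed.

(** * Threshold cuts *)

Section ThresholdCut.
Variables (R : realType) (V E : finType) (src dst : E -> V).
Variables (len : E -> nat) (N : nat) (H : R) (w : E -> R).
Hypotheses (N_gt0 : (0 < N)%N) (H_gt0 : 0 < H) (w_ge0 : forall e, 0 <= w e).

(* A simple path has fewer than [N] edges, so the edges of weight below
   [t / (2 N)] carry less than half of any path weight [>= t]. *)
Definition threshold_weight (t : R) (e : E) : R :=
  if t <= 2 * N%:R * w e then Num.min (2 * w e / t) 1 else 0.

Definition threshold_cut (t : R) (e : E) : R :=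
  (Num.truncn (H * threshold_weight t e))%:R / H.

Lemma threshold_weight_ge0 t e : 0 < t -> 0 <= threshold_weight t e.
Proof.
move=> t0; rewrite /threshold_weight; case: ifP => // _.
by rewrite le_min ler01 andbT divr_ge0 ?mulr_ge0 // ltW.
Qed.

Lemma threshold_cut_ge0 t e : 0 <= threshold_cut t e.
Proof. by rewrite divr_ge0 ?ler0n // ltW. Qed.

Lemma threshold_cut_le t e : 0 < t -> threshold_cut t e <= threshold_weight t e.
Proof.
move=> t0; rewrite ler_pdivrMr // mulrC truncn_le.
by rewrite mulr_ge0 ?threshold_weight_ge0 // ltW.
Qed.

Lemma moving_threshold_cut t : 0 < t -> moving_cut H (threshold_cut t).
Proof.
move=> t0 e; split; first by eexists.
rewrite threshold_cut_ge0 /=; apply: le_trans (threshold_cut_le e t0) _.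
by rewrite /threshold_weight; case: ifP => // _; rewrite ge_min lexx orbT.
Qed.

(** If no edge reaches weight 1, the minimum is never capped, so each edge has weight at least
    [2 w / t - 1 / N], dropped edges included; summing over at most [N] edges leaves [2 - 1]. *)
Lemma threshold_weight_path t p : 0 < t -> (size p <= N)%N -> t <= plen w p ->
  1 <= plen (threshold_weight t) p.
Proof.
move=> t0 szp tp.
have m0 e := threshold_weight_ge0 e t0.
have [/hasP[e ep e1]|] := boolP (has (fun e => 1 <= threshold_weight t e) p).
  by apply: le_trans e1 _; rewrite /plen (big_rem e) //= lerDl; apply: sumr_ge0.
move=> /hasPn small.
have N0 : 0 < N%:R :> R by rewrite ltr0n.
have key e : e \in p -> 2 / t * w e - N%:R^-1 <= threshold_weight t e.
  move=> /small; rewrite -ltNge /threshold_weight; case: ifP => [_|/negbT].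
    have N1 : 0 <= N%:R^-1 :> R by rewrite invr_ge0 ltW.
    rewrite gt_min ltxx orbF mulrAC => lt1.
    by rewrite le_min !lerBlDr; apply/andP; split; lra.
  rewrite -ltNge => lt _.
  rewrite subr_le0 mulrAC ler_pdivrMr // ler_pdivlMl //; lra.
apply: (@le_trans _ _ (plen (fun e => 2 / t * w e - N%:R^-1) p)); last first.
  by rewrite /plen !big_seq; apply: ler_sum.
rewrite plenD plenZ.
have -> : plen (fun=> - N%:R^-1) p = - ((size p)%:R / N%:R) :> R.
  by rewrite /plen big_const_seq count_predT iter_addr_0 mulNrn mulr_natl.
have : (size p)%:R / N%:R <= 1 :> R by rewrite ler_pdivrMr // mul1r ler_nat.
have : 2 <= 2 / t * plen w p by rewrite mulrAC ler_pdivlMr // ler_pM2l.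
by lra.
Qed.

Lemma threshold_cut_separates t u v : 0 < t ->
  (#|V| <= N)%N -> (forall e, 0 < len e)%N ->
  (forall p, is_simple_path src dst u v p -> plen (lenR R len) p <= H ->
     t <= plen w p) ->
  (H%:E < dist src dst (len_minus_cut len H (threshold_cut t)) u v)%E.
Proof.
move=> t0 VN len0 tp.
pose k e := (len e + Num.truncn (H * threshold_weight t e))%N.
have kE p : plen (len_minus_cut len H (threshold_cut t)) p = (\sum_(e <- p) k e)%:R.
  rewrite natr_sum; apply: eq_bigr => e _.
  by rewrite /len_minus_cut /threshold_cut natrD mulrCA divff ?mulr1 ?gt_eqF.
(* Lengths in the cut graph are integers, so exceeding [H] means reaching the next integer; this
   keeps the inequality strict through the infimum. *)
apply: (@lt_le_trans _ _ (Num.truncn H).+1%:R%:E).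
  by rewrite lte_fin; have /andP[] := truncn_itv (ltW H_gt0).
apply: le_ereal_inf_tmp => _ [p wp <-]; rewrite lee_fin kE ler_nat.
rewrite truncn_lt_nat ?ltW // -kE ltNge; apply/negP => leH.
(* A walk of length at most [H] in the cut graph yields a simple path no longer than it, hence also
   of length at most [H] in the original graph. *)
have [q [sq lq]] := walk_simple_path R wp.
have {leH} : plen (len_minus_cut len H (threshold_cut t)) q <= H.
  apply: le_trans leH; apply: lq => e; rewrite addr_ge0 ?ler0n //.
  by rewrite mulr_ge0 ?threshold_cut_ge0 // ltW.
have lenq0 : 0 <= H * plen (threshold_cut t) q.
  by rewrite mulr_ge0 ?(ltW H_gt0) // plen_ge0 // => e; exact: threshold_cut_ge0.
move=> leH; have /(tp _ sq) tq : plen (lenR R len) q <= H.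
  by move: leH; rewrite plenD plenZ /lenR; lra.
have : H * plen (threshold_weight t) q < plen (len_minus_cut len H (threshold_cut t)) q.
  (* rounding down costs less than one unit per edge, which the length of the edge pays for *)
  rewrite -plenZ; have key e : H * threshold_weight t e < len_minus_cut len H (threshold_cut t) e.
    have /andP[_] : (Num.truncn (H * threshold_weight t e))%:R <= H * threshold_weight t e
        < (Num.truncn (H * threshold_weight t e)).+1%:R.
      by apply: truncn_itv; rewrite mulr_ge0 ?threshold_weight_ge0 // ltW.
    move=> /lt_le_trans; apply; rewrite /len_minus_cut /threshold_cut.
    rewrite mulrCA divff ?mulr1 ?gt_eqF // -natrD ler_nat -[X in (X <= _)%N]add1n.
    by rewrite leq_add2r.
  (* Since [t > 0], the path is not empty, and its first edge makes the inequality strict. *)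
  case: q tq {sq lq lenq0 leH} => [|e q _]; first by rewrite /plen big_nil leNgt t0.
  by rewrite !plen_cons ltr_leD // le_plen // => e'; exact: ltW.
have := threshold_weight_path t0 (leq_trans (ltnW (simple_path_size sq)) VN) tq.
by rewrite -(ler_pM2l H_gt0) mulr1; lra.
Qed.

Lemma sum_threshold_cut_le t M e : (2 <= N)%N -> 0 < t ->
  \sum_(i < M) t * 2 ^+ i * threshold_cut (t * 2 ^+ i) e <= 16 * ln N%:R * w e.
Proof.
move=> N2 t0; pose T i := t * 2 ^+ i.
have T0 i : 0 < T i by rewrite mulr_gt0 ?exprn_gt0.
have w2 : 0 <= 2 * w e by rewrite mulr_ge0.
set L := trunc_log 2 N.
(* Scales up to [2 w] cost at most [T i] each, higher ones at most [2 w] each, and an edge is kept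
   only while [T i <= 2 N w], where [N <= 2 ^ L.+1]. *)
apply: (@le_trans _ _ (\sum_(i < M | T i <= 2 * w e) T i +
  2 * w e * \sum_(i < M | 2 * w e < T i <= 2 ^+ L.+1 * (2 * w e)) 1)).
  rewrite mulr_sumr [X in _ <= X + _]big_mkcond [X in _ <= _ + X]big_mkcond -big_split /=.
  apply: ler_sum => i _; rewrite -/(T i); move: (T i) (T0 i) => {}t' {}t'0.
  apply: (@le_trans _ _ (t' * threshold_weight t' e)).
    by rewrite ler_pM2l // threshold_cut_le.
  rewrite /threshold_weight; case: ifP => [tN|_]; last first.
    by rewrite mulr0; apply: addr_ge0; case: ifP => // _; [exact: ltW|rewrite mulr1].
  have tN' : t' <= 2 ^+ L.+1 * (2 * w e).
    apply: le_trans tN _; rewrite mulrAC mulrC ler_wpM2r //.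
    by rewrite -natrX ler_nat ltnW // trunc_log_ltn.
  rewrite tN' andbT; case: leP => [tw|tw] /=.
    by rewrite addr0 ger_pMr // ge_min lexx orbT.
  by rewrite add0r mulr1 -ler_pdivlMl // ge_min [_^-1 * _]mulrC lexx.
have := sum_dyadic_le M t0 w2; rewrite -/(T _) => leS.
have leC := @count_dyadic_le R t _ M L.+1 t0 w2.
apply: (@le_trans _ _ (2 * (2 * w e) + 2 * w e * L.+1%:R)).
  by rewrite lerD // ler_wpM2l.
apply: (@le_trans _ _ ((6 + 2 * L%:R) * w e)); first by rewrite -natr1; lra.
by rewrite ler_wpM2r // trunc_log2_le_ln.
Qed.

End ThresholdCut.

(** * Routing by linear programming duality *)

(** Take for [t] the least positive value, capped at 1; [M] comes from [n < 2 ^ n]. *)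
Lemma dyadic_range (R : realType) (I : finType) (y : I -> R) :
  exists (t : R) (M : nat), 0 < t /\
    forall i, y i <= t * 2 ^+ M /\ (0 < y i -> t <= y i).
Proof.
pose t := \big[Num.min/1]_(i | 0 < y i) y i.
have t0 : 0 < t by apply: (big_ind (fun z => 0 < z)) => // a b a0 b0; rewrite lt_min a0 b0.
pose S := \sum_i `|y i|.
exists t, (Num.truncn (S / t)).+1; split=> // i; split=> [|yi].
  have yS : y i <= S.
    by apply: le_trans (ler_norm _) _; rewrite /S (bigD1 i) //= lerDl sumr_ge0.
  rewrite mulrC -ler_pdivrMr //; apply: (@le_trans _ _ (S / t)).
    by rewrite ler_pM2r ?invr_gt0.
  have S0 : 0 <= S / t by rewrite divr_ge0 ?sumr_ge0 // ltW.
  have /andP[_ /ltW/le_trans] := truncn_itv S0; apply.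
  by rewrite -natrX ler_nat ltnW // ltn_expl.
exact: bigmin_le_cond.
Qed.

Section Routing.
Variables (R : realType) (V E : finType) (src dst : E -> V).
Variables (len cap : E -> nat) (N : nat) (A : V -> R) (h s phi : R).
Hypotheses (N_ge2 : (2 <= N)%N) (V_le_N : (#|V| <= N)%N).
Hypotheses (len_gt0 : forall e, (0 < len e)%N) (cap_gt0 : forall e, (0 < cap e)%N).
Hypotheses (hs_gt0 : 0 < h * s) (phi_gt0 : 0 < phi).
Hypothesis A_expanding : expanding src dst len cap h s phi A.
Variable D : V -> V -> R.
Hypothesis D_valid : valid_demand src dst len A h D.

(** Here [y] prices the demands and [w] the capacities. The constant is [32 = 2 * 16]: a factor 2
    from replacing [y] by dyadic scales, 16 from the threshold cuts. *)
Lemma expanding_dual_bound (y : V * V -> R) (w : E -> R) :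
  (forall e, 0 <= w e) ->
  (forall u v p, is_simple_path src dst u v p ->
     plen (lenR R len) p <= h * s -> y (u, v) <= plen w p) ->
  \sum_p D p.1 p.2 * y p <= 32 * ln N%:R / phi * \sum_e (cap e)%:R * w e.
Proof.
move=> w0 yw; have [t [M [t0 tM]]] := dyadic_range y.
have D0 u v : 0 <= D u v by case: D_valid.
pose T i := t * 2 ^+ i.
have T0 i : 0 < T i by rewrite mulr_gt0 ?exprn_gt0.
have N0 : (0 < N)%N by exact: ltnW.
pose C i := threshold_cut N (h * s) w (T i).
(* The cut at scale [T i] separates every pair with [y >= T i], so expansion bounds the demand of
   these pairs. *)
have sepC i : T i * (\sum_(p | T i <= y p) D p.1 p.2) <= T i * cut_size cap (C i) / phi.
  rewrite -mulrA ler_pM2l // ler_pdivlMr // mulrC.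
  apply: le_trans (expanding_sep_le A_expanding D_valid
    (moving_threshold_cut N hs_gt0 w0 (T0 i))).
  rewrite ler_pM2l // /sep [leLHS]big_mkcond [leRHS]big_mkcond /=; apply: ler_sum => -[u v] _ /=.
  case: ifP => [Ty|_]; last by case: ifP.
  rewrite threshold_cut_separates // => p sp lp.
  exact: le_trans (yw _ _ _ sp lp).
apply: (@le_trans _ _ (2 * \sum_(i < M.+1) T i * cut_size cap (C i) / phi)).
  apply: (@le_trans _ _ (2 * \sum_(i < M.+1) T i * (\sum_(p | T i <= y p) D p.1 p.2))); last first.
    by rewrite ler_pM2l //; apply: ler_sum.
  under [X in _ <= 2 * X]eq_bigr do rewrite mulr_sumr.
  rewrite (exchange_big_dep predT) //= mulr_sumr; apply: ler_sum => p _.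
  have [yM ty] := tM p; rewrite -mulr_suml mulrA mulrC ler_wpM2r //.
  exact: le_sum_dyadic.
rewrite -mulr_suml.
have -> : \sum_(i < M.+1) T i * cut_size cap (C i) =
    \sum_e (cap e)%:R * \sum_(i < M.+1) T i * C i e.
  under eq_bigr do rewrite mulr_sumr; rewrite exchange_big /=.
  by apply: eq_bigr => e _; rewrite mulr_sumr; apply: eq_bigr => i _; rewrite mulrCA.
have : \sum_e (cap e)%:R * \sum_(i < M.+1) T i * C i e <=
    16 * ln N%:R * \sum_e (cap e)%:R * w e.
  rewrite mulr_sumr; apply: ler_sum => e _.
  by rewrite mulrCA ler_wpM2l // sum_threshold_cut_le.
move: (\sum_e (cap e)%:R * \sum_(i < M.+1) T i * C i e)
  (\sum_e (cap e)%:R * w e) => X W leX.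
have -> : 32 * ln N%:R / phi * W = 2 * (16 * ln N%:R * W / phi) by ring.
by rewrite ler_pM2l // ler_pM2r ?invr_gt0.
Qed.

Lemma expanding_routable :
  routable src dst len cap D (32 * ln N%:R / phi) (h * s).
Proof.
set kappa := 32 * ln N%:R / phi.
(* Simple paths have fewer than [#|V|] edges, so bounded sequences give a finite type containing all
   of them. *)
pose P : finType := (V * V * #|V|.-bseq E)%type.
pose ok (q : P) := is_simple_path src dst q.1.1 q.1.2 q.2 &&
  (plen (lenR R len) q.2 <= h * s).
(* Columns are path variables and edge slacks; rows are the demand equations and, thanks to the
   slacks, capacity equations. *)
pose a (j : P + E) (i : V * V + E) : R :=
  match j, i with
  | inl q, inl uv => (q.1 == uv)%:R
  | inl q, inr e => (e \in (q.2 : seq E))%:R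
  | inr _, inl _ => 0
  | inr e', inr e => (e' == e)%:R
  end.
pose g (i : V * V + E) : R :=
  match i with inl uv => D uv.1 uv.2 | inr e => kappa * (cap e)%:R end.
pose okj (j : P + E) := if j is inl q then ok q else true.
have [||c [c0 cg]] := @farkas R _ _ a [seq j <- index_enum _ | okj j] g.
- by rewrite filter_uniq // index_enum_uniq.
- move=> x xs.
  have xa j : okj j -> \sum_i a j i * x i <= 0.
    by move=> oj; apply: xs; rewrite mem_filter oj mem_index_enum.
  (* The slack columns force [x (inr e) <= 0], so [- x (inr e)] can serve as the weight of [e]. *)
  have x0 e : 0 <= - x (inr e).
    have := xa (inr e) isT; rewrite big_sumType /= big1 ?add0r => [|i _]; last by rewrite mul0r.
    rewrite (bigD1 e) //= eqxx mul1r big1 ?addr0 ?oppr_ge0 // => e' /negPf.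
    by rewrite eq_sym => ->; rewrite mul0r.
  have := @expanding_dual_bound (fun uv => x (inl uv)) (fun e => - x (inr e)) x0.
  rewrite big_sumType /= => dual.
  have {dual} : \sum_p D p.1 p.2 * x (inl p) <= kappa * \sum_e (cap e)%:R * - x (inr e).
    apply: dual => u v p sp lp.
    have szp : (size p <= #|V|)%N by exact: ltnW (simple_path_size sp).
    (* The column of [p] says that [x (inl (u, v))] is at most the weight of [p]. *)
    have := xa (inl (u, v, Bseq szp)); rewrite /= /ok sp lp => /(_ isT).
    rewrite big_sumType /= (bigD1 (u, v)) //= eqxx mul1r big1 ?addr0; last first.
      by move=> i /negPf; rewrite eq_sym => ->; rewrite mul0r.
    rewrite /plen (big_uniq _ (simple_path_uniq sp)) /= sumrN.
    suff -> : \sum_i (i \in p)%:R * x (inr i) = \sum_(i in p) x (inr i) by lra.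
    rewrite [RHS]big_mkcond; apply: eq_bigr => e _.
    by case: (e \in p); rewrite ?mul1r ?mul0r.
  rewrite mulr_sumr -subr_le0 -sumrN; congr (_ + _ <= 0); apply: eq_bigr => e _.
  by rewrite !mulrN opprK mulrA.
(* The coefficients of the path columns form the flow. *)
pose fl (q : P) : V * V * seq E * R := (q.1, bseqval q.2, c (inl q)).
pose F : flow R V E := [seq fl q | q <- index_enum P & ok q].
have sumF (Q : V * V * seq E * R -> bool) : \sum_(z <- F | Q z) z.2 =
    \sum_(q | ok q && Q (fl q)) c (inl q).
  by rewrite /F big_map big_filter_cond.
have FP z : z \in F -> exists2 q : P, ok q & z = fl q.
  by move=> /mapP[q]; rewrite mem_filter => /andP[oq _] ->; exists q.
have gE i : g i = \sum_(q | ok q) c (inl q) * a (inl q) i + \sum_e c (inr e) * a (inr e) i.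
  by rewrite cg big_filter big_sumType.
exists F; split.
- split=> [z /FP[q /andP[sq _] ->]|u v]; first by split=> /=.
  have := gE (inl (u, v)); rewrite /= [X in _ + X]big1 ?addr0 => [->|e _]; last by rewrite mulr0.
  rewrite sumF big_mkcondr; apply: eq_bigr => -[[u' v'] p] _ /=.
  by rewrite -xpair_eqE; case: eqP; rewrite ?mulr1 ?mulr0.
- move=> e; rewrite ler_pdivrMr ?ltr0n //.
  have := gE (inr e); rewrite /= => ->.
  (* Dropping the nonnegative slack of [e] leaves the capacity bound. *)
  rewrite -[leLHS]addr0 lerD //; last by apply: sumr_ge0 => i _; rewrite mulr_ge0.
  rewrite /edge_flow sumF big_mkcondr; apply: ler_sum => q _ /=.
  by case: ifP => _; rewrite ?mulr1 ?mulr0.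
- by move=> z /FP[q /andP[_ lq] ->] _.
Qed.

End Routing.

Theorem theorem3p8 :
  exists c : nat,
  forall (R : realType) (V E : finType) (src dst : E -> V)
         (len cap : E -> nat) (N : nat),
    (2 <= N)%N -> (#|V| <= N)%N ->
    (forall e, 0 < len e <= N)%N -> (forall e, 0 < cap e <= N)%N ->
  forall (A : V -> R) (h s phi : R),
    (forall v, 0 <= A v) -> 1 <= h -> 1 <= s -> 0 < phi < 1 ->
    (expanding src dst len cap h s phi A ->
       forall D : V -> V -> R, valid_demand src dst len A h D ->
         routable src dst len cap D (c%:R * ln (N%:R) / phi) (h * s))
    /\
    (~ expanding src dst len cap h s phi A ->
       exists D : V -> V -> R, valid_demand src dst len A h D /\
         ~ routable src dst len cap D (1 / (2 * phi)) (h * s / 2)).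
Proof.
exists 32%N => R V E src dst len cap N N2 VN lenN capN A h s phi _ h1 s1 /andP[phi0 _].
have hs0 : 0 < h * s by rewrite mulr_gt0 // (lt_le_trans ltr01).
have len0 e : (0 < len e)%N by case/andP: (lenN e).
have cap0 e : (0 < cap e)%N by case/andP: (capN e).
split=> [ex D vD|]; last exact: not_expanding_unroutable.
exact: expanding_routable ex D vD.
Qed.
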